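(* If $\eta<\mu<2\eta$ and $\gamma>\gamma_1$, then with $b_2=b_2^\gamma:=\inf\{x>0:v'(x)<1\}=\bar x+g_2^{-1}(f_1(\gamma))$ the function $v:[0,\infty)\to\mathbb{R}$, $v(0)=0$, given (and extended by continuity at $\bar x$ and $b_2$) by $$v(x)=\begin{cases}c_{2,1}e^{-\mathsf{x}_1^{-1}(x)}\big[e^{[1+\delta\bar\eta][M(b_2)+\mathsf{x}_1^{-1}(x)]}-1\big]&x\in(0,\bar x),\\ e^{M(b_2)}c_{2,2}^{-1/[1+\delta\bar\eta]}h_2(x-\bar x)&x\in(\bar x,b_2),\\ c_{2,3}(b_2)e^{\lambda_\gamma[x-b_2]}+\frac{\gamma}{\gamma+\delta}\big[x-b_2+v(b_2)+\frac{\eta}{\delta+\gamma}\big]&x\in(b_2,\infty),\end{cases}$$ is a $C^2$, increasing and concave solution on $(0,\infty)$ of the HJB equation (see context). Furthermore, $v'/v''$ is decreasing on $(0,\infty)$ and satisfies $\lim_{x\downarrow0}\frac{\mu}{\sigma^2}\frac{v'(x)}{v''(x)}>-1$, and $b_1^\gamma:=\inf\{x>0:-\frac{\mu}{\sigma^2}\frac{v'(x)}{v''(x)}\ge1\}=\bar x$.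
   Context: Constants: $\mu>\eta>0$, $\sigma>0$, $\delta>0$, $\gamma>0$. HJB equation: $$\max_{0\le u\le 1,\;0\le\xi\le x}\Big\{\tfrac12\sigma^2u^2v''(x)+[\eta-(1-u)\mu]v'(x)-\delta v(x)+\gamma[\xi+v(x-\xi)-v(x)]\Big\}=0\ \ (x>0),\qquad v(0)=0.$$ $\lambda_\gamma$ is the negative root of $\frac{\sigma^2}{2}r^2+\eta r-(\delta+\gamma)=0$; $\theta_+>0>\theta_-$ are the roots of $\frac{\sigma^2}{2}r^2+\eta r-\delta=0$. $\bar\eta=\frac{2\sigma^2}{\mu^2}$, $c_{2,1}=\frac{\bar\eta[\mu-\eta]}{1+\delta\bar\eta}$, $c_{2,2}=\frac{\delta\bar\eta\mu+2\eta-\mu}{2\delta\bar\eta[\mu-\eta]}$, $\bar x=\frac{c_{2,1}}{1+\delta\bar\eta}\ln c_{2,2}+\frac{\bar\eta[2\eta-\mu]}{2[1+\delta\bar\eta]}$. $h_2(x)=\frac{1}{\theta_+-\theta_-}[a_1e^{\theta_+x}-a_2e^{\theta_-x}]$ with $a_1=1-\theta_-\frac{2\eta-\mu}{2\delta}$, $a_2=1-\theta_+\frac{2\eta-\mu}{2\delta}$. $g_2(b)=h_2(b)/h_2'(b)$ for $b>0$; $g_2$ is increasing from $g_2(0+)=\frac{2\eta-\mu}{2\delta}$ to $g_2(\infty)=1/\theta_+$, with inverse $g_2^{-1}$. $f_1(\gamma)=\frac{1}{\lambda_\gamma\delta}\big[\delta+\frac{\lambda_\gamma\eta\gamma}{\delta+\gamma}\big]$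 for $\gamma>0$; it is strictly increasing from $f_1(0+)=1/\theta_-$ to $f_1(\infty)=\eta/\delta<1/\theta_+$. $\gamma_1=f_1^{-1}\big(\frac{2\eta-\mu}{2\delta}\big)$. $$M(b_2)=\ln\left[\frac{\frac{\gamma}{\gamma+\delta}-\frac{\lambda_\gamma\eta\gamma}{(\delta+\gamma)^2}}{c_{2,2}^{-1/[1+\delta\bar\eta]}\big[h_2'(b_2-\bar x)-\frac{\lambda_\gamma\delta}{\delta+\gamma}h_2(b_2-\bar x)\big]}\right],\quad c_{2,3}(b_2)=\frac{e^{M(b_2)}\delta c_{2,2}^{-1/[1+\delta\bar\eta]}}{\delta+\gamma}h_2(b_2-\bar x)-\frac{\eta\gamma}{(\delta+\gamma)^2}.$$ $\mathsf{x}_1^{-1}$ is the inverse of the increasing function $$\mathsf{x}_1(z)=\frac{\delta\bar\eta c_{2,1}}{1+\delta\bar\eta}e^{[1+\delta\bar\eta][z+M(b_2)]}+c_{2,1}z+c_{2,1}\Big[M(b_2)-\frac{\delta\bar\eta}{1+\delta\bar\eta}\Big],\quad z\in[-M(b_2),\bar z(b_2)],\ \ \bar z(b_2)=\frac{\ln c_{2,2}}{1+\delta\bar\eta}-M(b_2),$$ which maps this interval onto $[0,\bar x]$. *)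

(* Defs.v *)
From Stdlib Require Import Reals ClassicalEpsilon.
From Coquelicot Require Import Coquelicot.
Open Scope R_scope.

(* An element of P, provided there is one; in the uses below it is unique. *)
Definition the (P : R -> Prop) : R := epsilon (inhabits 0) P.

(* The inverse at y of the restriction to D of an injective function f. *)
Definition inverse_on (D : R -> Prop) (f : R -> R) (y : R) : R :=
  the (fun x => D x /\ f x = y).

Definition Rgt0 (x : R) : Prop := 0 < x.

Definition is_max (E : R -> Prop) (m : R) : Prop :=
  E m /\ forall y, E y -> y <= m.

Definition increasing_on (D : R -> Prop) (f : R -> R) : Prop :=
  forall x y, D x -> D y -> x < y -> f x < f y.

Definition decreasing_on (D : R -> Prop) (f : R -> R) : Prop :=
  forall x y, D x -> D y -> x < y -> f y < f x.

(* D is meant to be convex. *)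
Definition concave_on (D : R -> Prop) (f : R -> R) : Prop :=
  forall x y t, D x -> D y -> 0 <= t <= 1 ->
    t * f x + (1 - t) * f y <= f (t * x + (1 - t) * y).

(* D is meant to be open. *)
Definition C2_on (D : R -> Prop) (f : R -> R) : Prop :=
  forall x, D x ->
    ex_derive_n f 1 x /\ ex_derive_n f 2 x /\ continuous (Derive_n f 2) x.

Section Model.

Context (mu eta sigma delta : R).

Definition char_poly (q r : R) : R := sigma ^ 2 / 2 * r ^ 2 + eta * r - q.
Definition neg_root (q : R) : R := the (fun r => r < 0 /\ char_poly q r = 0).
Definition pos_root (q : R) : R := the (fun r => 0 < r /\ char_poly q r = 0).

Definition lambda (gamma : R) : R := neg_root (delta + gamma).
Definition theta_plus : R := pos_root delta.
Definition theta_minus : R := neg_root delta.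

Definition eta_bar : R := 2 * sigma ^ 2 / mu ^ 2.

Definition c21 : R := eta_bar * (mu - eta) / (1 + delta * eta_bar).

Definition c22 : R :=
  (delta * eta_bar * mu + 2 * eta - mu) / (2 * delta * eta_bar * (mu - eta)).

Definition x_bar : R :=
  c21 / (1 + delta * eta_bar) * ln c22
  + eta_bar * (2 * eta - mu) / (2 * (1 + delta * eta_bar)).

Definition a1 : R := 1 - theta_minus * ((2 * eta - mu) / (2 * delta)).
Definition a2 : R := 1 - theta_plus * ((2 * eta - mu) / (2 * delta)).

Definition h2 (x : R) : R :=
  1 / (theta_plus - theta_minus)
  * (a1 * exp (theta_plus * x) - a2 * exp (theta_minus * x)).

Definition g2 (b : R) : R := h2 b / Derive h2 b.

Definition f1 (gamma : R) : R :=
  1 / (lambda gamma * delta)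
  * (delta + lambda gamma * eta * gamma / (delta + gamma)).

Definition gamma1 : R := inverse_on Rgt0 f1 ((2 * eta - mu) / (2 * delta)).

Context (gamma : R).

Definition b2_gamma : R := x_bar + inverse_on Rgt0 g2 (f1 gamma).

Definition kappa : R := Rpower c22 (- 1 / (1 + delta * eta_bar)).

Definition M (b2 : R) : R :=
  ln ((gamma / (gamma + delta)
       - lambda gamma * eta * gamma / (delta + gamma) ^ 2)
      / (kappa * (Derive h2 (b2 - x_bar)
                  - lambda gamma * delta / (delta + gamma) * h2 (b2 - x_bar)))).

Definition c23 (b2 : R) : R :=
  exp (M b2) * delta * kappa / (delta + gamma) * h2 (b2 - x_bar)
  - eta * gamma / (delta + gamma) ^ 2.

Definition z_bar (b2 : R) : R := ln c22 / (1 + delta * eta_bar) - M b2.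

Definition x1 (b2 z : R) : R :=
  delta * eta_bar * c21 / (1 + delta * eta_bar)
    * exp ((1 + delta * eta_bar) * (z + M b2))
  + c21 * z
  + c21 * (M b2 - delta * eta_bar / (1 + delta * eta_bar)).

Definition x1_inv (b2 x : R) : R :=
  inverse_on (fun z => - M b2 <= z <= z_bar b2) (x1 b2) x.

(* Functions on [0, oo) are represented by functions on R whose values on
   (-oo, 0) are irrelevant.  Continuity at x_bar and b2 fixes the values
   there, including the v b2 of the last clause. *)
Definition is_candidate (b2 : R) (v : R -> R) : Prop :=
  v 0 = 0 /\
  (forall x, 0 < x < x_bar ->
     v x = c21 * exp (- x1_inv b2 x)
           * (exp ((1 + delta * eta_bar) * (M b2 + x1_inv b2 x)) - 1)) /\
  (forall x, x_bar < x < b2 ->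
     v x = exp (M b2) * kappa * h2 (x - x_bar)) /\
  (forall x, b2 < x ->
     v x = c23 b2 * exp (lambda gamma * (x - b2))
           + gamma / (gamma + delta)
             * (x - b2 + v b2 + eta / (delta + gamma))) /\
  continuous v x_bar /\
  continuous v b2.

Definition hamiltonian (v : R -> R) (x u xi : R) : R :=
  / 2 * sigma ^ 2 * u ^ 2 * Derive_n v 2 x
  + (eta - (1 - u) * mu) * Derive v x
  - delta * v x
  + gamma * (xi + v (x - xi) - v x).

Definition HJB_solution (v : R -> R) : Prop :=
  v 0 = 0 /\
  forall x, 0 < x ->
    is_max (fun y => exists u xi, 0 <= u <= 1 /\ 0 <= xi <= x /\
                       y = hamiltonian v x u xi) 0.

End Model.

(* Main.v *)
(* On each of the three intervals the value function solves an ODE explicitly: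
   left of [x_bar] it is parametrized by [z = - ln v'], so that [v'/v''] equals
   [- x1'(z)]; between [x_bar] and [b2] it is a multiple of [h2]; right of [b2]
   it solves the linear equation with the jump [xi = x - b2].  Each piece
   extends smoothly to the whole line, and the constants make the values and
   the first two derivatives match at [x_bar] and [b2].  At [b2] this rests on
   [g2 (b2 - x_bar) = f1 gamma], which forces [v' b2 = 1].

   In terms of the roots, [f1 = eta / delta + sigma^2 / (sigma^2 lambda + 2 eta)].
   This gives the monotonicity of [f1], an explicit [gamma1], and
   [f1 gamma < eta / delta]; the last inequality is [h2'' < 0] at
   [b2 - x_bar], hence the concavity of [v] up to [b2].

   Given concavity and the monotonicity of [v'/v''], the HJB equation follows
   by maximizing separately over [u], a concave quadratic with vertex at
   [- (mu / sigma^2) v'/v''], and over [xi], where the tangent line to [v] at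
   [min x b2] bounds the jump term. *)

Require Import Defs.
From Stdlib Require Import Reals Ranalysis5 Lra Psatz.
From Coquelicot Require Import Coquelicot.
Open Scope R_scope.

(** * Pasting and inverting differentiable functions *)

Lemma the_spec (P : R -> Prop) : (exists x, P x) -> P (the P).
Proof. exact (ClassicalEpsilon.epsilon_spec (inhabits 0) P). Qed.

Lemma is_derive_positive_increasing (f df : R -> R) :
  (forall x, is_derive f x (df x)) -> (forall x, 0 < df x) ->
  forall x y, x < y -> f x < f y.
Proof.
  intros d_f pos x y xy.
  apply (incr_function f m_infty p_infty df); simpl; auto.
  intros z _ _; apply pos.
Qed.

Lemma mean_value (f df : R -> R) (x y : R) :
  (forall x, is_derive f x (df x)) ->
  exists c, Rmin x y <= c <= Rmax x y /\ f y - f x = df c * (y - x).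
Proof.
  intros d_f. apply MVT_gen.
  - auto.
  - intros z _. apply derivable_continuous_pt.
    exists (df z). apply is_derive_Reals, d_f.
Qed.

(** The lower bound [m] on the derivative makes [g] Lipschitz with constant [/ m], hence continuous,
    which the derivative of a reciprocal function presupposes. *)
Lemma is_derive_global_inverse (f df g : R -> R) (m : R) :
  0 < m -> (forall x, is_derive f x (df x)) -> (forall x, m <= df x) ->
  (forall y, f (g y) = y) -> forall y, is_derive g y (/ df (g y)).
Proof.
  intros m_gt0 d_f df_ge fg y.
  assert (lip : forall h, m * Rabs (g (y + h) - g y) <= Rabs h).
  { intros h.
    destruct (mean_value f df (g y) (g (y + h)) d_f) as [c [_ Ec]].
    rewrite !fg in Ec. replace (y + h - y) with h in Ec by ring.
    assert (Ea : Rabs h = df c * Rabs (g (y + h) - g y)).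
    { rewrite Ec at 1. rewrite Rabs_mult, (Rabs_pos_eq (df c)); auto.
      specialize (df_ge c); lra. }
    rewrite Ea. apply Rmult_le_compat_r; [apply Rabs_pos | apply df_ge]. }
  assert (g_mono : forall u v, u < v -> g u <= g v).
  { intros u v uv. destruct (Rle_dec (g u) (g v)) as [|n]; auto.
    assert (f (g v) < f (g u)); [|rewrite !fg in *; lra].
    apply is_derive_positive_increasing with df; auto; [|lra].
    intros z; specialize (df_ge z); lra. }
  assert (g_cont : continuity_pt g y).
  { intros eps eps_gt0. exists (m * eps); split; [nra|].
    intros z [_ Hz]; simpl in *; unfold Rdist in *.
    specialize (lip (z - y)). replace (y + (z - y)) with z in lip by ring.
    nra. }
  (* An explicit term, so that [derive_pt] at [pr] computes to [df]. *)
  pose (pr := fun (a : R) (_ : g (y - 1) <= a <= g (y + 1)) =>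
    exist (derivable_pt_lim f a) (df a)
      (proj1 (is_derive_Reals f a (df a)) (d_f a)) : derivable_pt f a).
  assert (g_in : g (y - 1) <= g y <= g (y + 1)) by (split; apply g_mono; lra).
  apply is_derive_Reals. rewrite <- Rdiv_1_l.
  refine (derivable_pt_lim_recip_interv f g (y - 1) (y + 1) y pr g_cont
            _ _ g_in _ _); try lra.
  - intros x _; apply fg.
  - simpl. specialize (df_ge (g y)); lra.
Qed.

Definition glue (c : R) (f g : R -> R) (x : R) : R :=
  if Rle_dec x c then f x else g x.

Lemma glue_left (c : R) (f g : R -> R) (x : R) : x <= c -> glue c f g x = f x.
Proof. unfold glue; destruct (Rle_dec x c); tauto || lra. Qed.

Lemma glue_right (c : R) (f g : R -> R) (x : R) :
  f c = g c -> c <= x -> glue c f g x = g x.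
Proof.
  unfold glue; intros E cx. destruct (Rle_dec x c); auto.
  replace x with c by lra; exact E.
Qed.

Lemma locally_lt (x c : R) : x < c -> locally x (fun y => y < c).
Proof. apply (open_lt c x). Qed.

Lemma locally_gt (x c : R) : c < x -> locally x (fun y => c < y).
Proof. apply (open_gt c x). Qed.

(** At [c] each difference quotient is one of [f] or one of [g], according to the sign of the
    increment; both tend to the common derivative. *)
Lemma is_derive_glue (c : R) (f g df dg : R -> R) :
  f c = g c -> df c = dg c ->
  (forall x, is_derive f x (df x)) -> (forall x, is_derive g x (dg x)) ->
  forall x, is_derive (glue c f g) x (glue c df dg x).
Proof.
  intros E dE d_f d_g x.
  destruct (Rtotal_order x c) as [xc | [-> | cx]].
  - rewrite glue_left by lra. apply is_derive_ext_loc with f; [|apply d_f].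
    apply filter_imp with (2 := locally_lt x c xc); intros y yc.
    rewrite glue_left; lra.
  - rewrite glue_left by lra. apply is_derive_Reals. intros eps eps_gt0.
    destruct (proj1 (is_derive_Reals f c (df c)) (d_f c) eps eps_gt0) as [r1 H1].
    rewrite dE in *.
    destruct (proj1 (is_derive_Reals g c (dg c)) (d_g c) eps eps_gt0) as [r2 H2].
    assert (r_gt0 : 0 < Rmin r1 r2) by (apply Rmin_glb_lt; apply cond_pos).
    exists (mkposreal _ r_gt0); simpl; intros h h0 hr.
    pose proof (Rmin_l r1 r2); pose proof (Rmin_r r1 r2).
    rewrite (glue_left _ _ _ c) by lra.
    destruct (Rle_dec (c + h) c).
    + rewrite glue_left by lra. apply H1; auto; lra.
    + rewrite glue_right, E by lra. apply H2; auto; lra.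
  - rewrite glue_right by lra. apply is_derive_ext_loc with g; [|apply d_g].
    apply filter_imp with (2 := locally_gt x c cx); intros y yc.
    rewrite glue_right; lra.
Qed.

Lemma continuous_glue (c : R) (f g : R -> R) :
  f c = g c -> (forall x, continuous f x) -> (forall x, continuous g x) ->
  forall x, continuous (glue c f g) x.
Proof.
  intros E c_f c_g x.
  destruct (Rtotal_order x c) as [xc | [-> | cx]].
  - apply continuous_ext_loc with f; [|apply c_f].
    apply filter_imp with (2 := locally_lt x c xc); intros y yc.
    rewrite glue_left; lra.
  - unfold continuous. rewrite glue_left by lra.
    intros P HP.
    pose proof (c_f c P HP) as H1.
    rewrite E in HP. pose proof (c_g c P HP) as H2.
    unfold filtermap in *.
    apply filter_imp with (2 := filter_and _ _ H1 H2).
    intros y [Hf Hg]; unfold glue; destruct (Rle_dec y c); auto.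
  - apply continuous_ext_loc with g; [|apply c_g].
    apply filter_imp with (2 := locally_gt x c cx); intros y yc.
    rewrite glue_right; lra.
Qed.

Lemma decreasing_glue (c : R) (f g : R -> R) :
  f c = g c ->
  (forall x y, x < y -> y <= c -> f y < f x) ->
  (forall x y, c <= x -> x < y -> g y < g x) ->
  forall x y, x < y -> glue c f g y < glue c f g x.
Proof.
  intros E df dg x y xy.
  destruct (Rle_dec y c) as [yc | cy]; [|destruct (Rle_dec c x) as [cx | xc]].
  - rewrite !glue_left by lra. auto.
  - rewrite !glue_right by lra. auto.
  - rewrite glue_right, glue_left by lra.
    apply Rlt_trans with (f c); [|apply df; lra].
    rewrite E; apply dg; lra.
Qed.

(** [P] may or may not hold at [b]. One statement thus serves both infima: the set defining [b2]
    omits its endpoint, the one defining [b1] contains it. *)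
Lemma Glb_Rbar_ray (P : R -> Prop) (b : R) :
  (forall x, P x -> b <= x) -> (forall x, b < x -> P x) -> Glb_Rbar P = Finite b.
Proof.
  intros lb ray. apply is_glb_Rbar_unique; split.
  - intros x Px; simpl; auto.
  - intros [l | |] Hl; simpl; auto.
    + destruct (Rle_dec l b) as [|n]; auto.
      specialize (Hl ((l + b) / 2)); simpl in Hl.
      assert (l <= (l + b) / 2) by (apply Hl, ray; lra). lra.
    + specialize (Hl (b + 1)); simpl in Hl. apply Hl, ray; lra.
Qed.

(** Left limits are unique. This recovers the values of a candidate at [x_bar] and [b2]. *)
Lemma continuous_eq_left (f g : R -> R) (a x : R) : a < x ->
  continuous f x -> continuous g x -> (forall y, a < y < x -> f y = g y) -> f x = g x.
Proof.
  intros ax cf cg E.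
  apply (filterlim_locally_unique (F := at_left x) f).
  - apply (filterlim_filter_le_1 _ (filter_le_within _)), cf.
  - apply filterlim_ext_loc with g.
    + assert (r_gt0 : 0 < x - a) by lra.
      exists (mkposreal _ r_gt0). intros y Hy yx. symmetry. apply E.
      apply Rabs_def2 in Hy. unfold minus, plus, opp in Hy. simpl in Hy. lra.
    + apply (filterlim_filter_le_1 _ (filter_le_within _)), cg.
Qed.

(** * Verification of a concave solution *)

Section Verification.

Context (mu eta sigma delta gamma xb b : R) (V DV D2V : R -> R).
Context (mu_gt0 : 0 < mu) (sigma_gt0 : 0 < sigma) (gamma_gt0 : 0 < gamma)
  (xb_gt0 : 0 < xb) (xb_lt_b : xb < b)
  (dV : forall x, is_derive V x (DV x))
  (dDV : forall x, is_derive DV x (D2V x))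
  (cD2V : forall x, continuous D2V x)
  (V0 : V 0 = 0)
  (DV_gt0 : forall x, 0 < DV x)
  (D2V_lt0 : forall x, D2V x < 0)
  (DV_b : DV b = 1)
  (ratio_decr : forall x y, x < y -> DV y / D2V y < DV x / D2V x)
  (ratio_xb : DV xb / D2V xb = - (sigma ^ 2 / mu))
  (ode_left : forall x, 0 < x <= xb ->
     - (mu ^ 2 / (2 * sigma ^ 2)) * (DV x ^ 2 / D2V x)
     - (mu - eta) * DV x - delta * V x = 0)
  (ode_middle : forall x, xb <= x <= b ->
     sigma ^ 2 / 2 * D2V x + eta * DV x - delta * V x = 0)
  (ode_right : forall x, b <= x ->
     sigma ^ 2 / 2 * D2V x + eta * DV x - (delta + gamma) * V x
     + gamma * (x - b + V b) = 0).

Lemma DV_decreasing (x y : R) : x < y -> DV y < DV x.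
Proof.
  intros xy. apply Ropp_lt_cancel.
  apply (is_derive_positive_increasing (fun x => - DV x) (fun x => - D2V x)); auto.
  - intros z. apply (is_derive_opp DV), dDV.
  - intros z. specialize (D2V_lt0 z); lra.
Qed.

(** By the mean value theorem, since [DV] decreases. Concavity and both bounds on the jump term rest
    on it. *)
Lemma tangent_above (x y : R) : V y <= V x + DV x * (y - x).
Proof.
  destruct (mean_value V DV x y dV) as [c [Hc E]].
  assert (DV c * (y - x) <= DV x * (y - x)); [|lra].
  destruct (Rle_dec x y) as [xy | yx].
  - rewrite Rmin_left, Rmax_right in Hc by lra.
    apply Rmult_le_compat_r; [lra|].
    destruct (Req_dec x c) as [->|]; [lra|].
    left; apply DV_decreasing; lra.
  - rewrite Rmin_right, Rmax_left in Hc by lra.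
    assert (DV x <= DV c); [|nra].
    destruct (Req_dec x c) as [->|]; [lra|].
    left; apply DV_decreasing; lra.
Qed.

Lemma DV_ge1 (x : R) : x <= b -> 1 <= DV x.
Proof.
  intros xb'. rewrite <- DV_b. destruct (Req_dec x b) as [->|]; [lra|].
  left; apply DV_decreasing; lra.
Qed.

(** The quantity equals 1 at [xb] by [ratio_xb] and is strictly increasing in [x]. *)
Lemma ratio_sign (x : R) :
  (x < xb -> - (mu / sigma ^ 2) * (DV x / D2V x) < 1) /\
  (xb <= x -> 1 <= - (mu / sigma ^ 2) * (DV x / D2V x)).
Proof.
  assert (E : - (mu / sigma ^ 2) * (DV xb / D2V xb) = 1).
  { rewrite ratio_xb; field; lra. }
  assert (k_gt0 : 0 < mu / sigma ^ 2).
  { apply Rdiv_lt_0_compat; [lra | apply pow_lt; lra]. }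
  split; intros H.
  - specialize (ratio_decr x xb H). nra.
  - destruct (Req_dec x xb) as [->|]; [lra|].
    assert (xb < x) as H' by lra. specialize (ratio_decr xb x H'). nra.
Qed.

(** The part of the Hamiltonian that depends on [u]; as a quadratic in [u] it has its vertex at
    [ratio x] below. *)
Definition control_value (x u : R) : R :=
  / 2 * sigma ^ 2 * u ^ 2 * D2V x + (eta - (1 - u) * mu) * DV x.

Let ratio (x : R) : R := - (mu / sigma ^ 2) * (DV x / D2V x).

Lemma ratio_eq (x : R) : mu * DV x = - sigma ^ 2 * D2V x * ratio x.
Proof. unfold ratio. specialize (D2V_lt0 x). field; lra. Qed.

Lemma control_value_ratio (x : R) :
  control_value x (ratio x)
  = - (mu ^ 2 / (2 * sigma ^ 2)) * (DV x ^ 2 / D2V x) - (mu - eta) * DV x.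
Proof. unfold control_value, ratio. specialize (D2V_lt0 x). field; lra. Qed.

(** Completing the square; the leading coefficient has the sign of [D2V x]. *)
Lemma control_value_le_ratio (x u : R) :
  control_value x u <= control_value x (ratio x).
Proof.
  assert (E : control_value x u = control_value x (ratio x)
      + / 2 * (sigma ^ 2 * D2V x * (u - ratio x) ^ 2)).
  { unfold control_value.
    replace ((eta - (1 - u) * mu) * DV x)
      with ((eta - mu) * DV x + u * (mu * DV x)) by ring.
    replace ((eta - (1 - ratio x) * mu) * DV x)
      with ((eta - mu) * DV x + ratio x * (mu * DV x)) by ring.
    rewrite ratio_eq; field. }
  rewrite E.
  assert (0 <= sigma ^ 2 * - D2V x * (u - ratio x) ^ 2); [|lra].
  specialize (D2V_lt0 x).
  apply Rmult_le_pos; [apply Rmult_le_pos; [apply pow2_ge_0 | lra] | apply pow2_ge_0].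
Qed.

(** A vertex at or beyond 1 puts the constrained maximum at [u = 1]: the difference factors, and
    [(1 + u) / 2 <= 1 <= ratio x]. *)
Lemma control_value_le_1 (x u : R) :
  0 <= u <= 1 -> 1 <= ratio x -> control_value x u <= control_value x 1.
Proof.
  intros u01 r_ge1.
  assert (E : control_value x 1 - control_value x u
      = (1 - u) * (sigma ^ 2 * - D2V x * (ratio x - (1 + u) / 2))).
  { unfold control_value.
    replace ((eta - (1 - u) * mu) * DV x)
      with ((eta - mu) * DV x + u * (mu * DV x)) by ring.
    replace ((eta - (1 - 1) * mu) * DV x)
      with ((eta - mu) * DV x + mu * DV x) by ring.
    rewrite ratio_eq; field. }
  assert (0 <= control_value x 1 - control_value x u); [|lra].
  rewrite E. specialize (D2V_lt0 x).
  apply Rmult_le_pos; [lra|].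
  apply Rmult_le_pos; [apply Rmult_le_pos; [apply pow2_ge_0 | lra] | lra].
Qed.

(** Up to [b] the slope is at least 1, so a jump of size [xi] costs at least [xi] in value. *)
Lemma jump_le_left (x xi : R) :
  x <= b -> 0 <= xi -> xi + V (x - xi) - V x <= 0.
Proof.
  intros x_le_b xi_ge0.
  pose proof (tangent_above x (x - xi)). pose proof (DV_ge1 x x_le_b). nra.
Qed.

(** The tangent at [b] has slope 1, so [xi] cancels; the bound is attained at [xi = x - b]. *)
Lemma jump_le_right (x xi : R) : xi + V (x - xi) - V x <= x - b + V b - V x.
Proof.
  pose proof (tangent_above b (x - xi)) as H. rewrite DV_b in H. lra.
Qed.

(** The maximizers [(u, xi)] are [(ratio x, 0)] left of [xb], [(1, 0)] on [[xb, b]] and [(1, x - b)]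
    beyond; the ODE of each region says that the value there is 0. *)
Lemma hamiltonian_is_max (x : R) : 0 < x ->
  is_max (fun y => exists u xi, 0 <= u <= 1 /\ 0 <= xi <= x /\
    y = control_value x u - delta * V x + gamma * (xi + V (x - xi) - V x)) 0.
Proof.
  intros x_gt0. destruct (ratio_sign x) as [r_lt1 r_ge1]; fold (ratio x) in *.
  (* Needed for [ratio x] to be an admissible control left of [xb]. *)
  assert (r_ge0 : 0 <= ratio x).
  { pose proof (ratio_eq x) as E. specialize (D2V_lt0 x). specialize (DV_gt0 x).
    pose proof (pow_lt sigma 2 sigma_gt0).
    assert (0 < sigma ^ 2 * - D2V x) by nra.
    assert (0 < mu * DV x) by nra. nra. }
  destruct (Rlt_dec x xb) as [x_lt | x_ge].
  - pose proof (ode_left x ltac:(lra)) as ode. rewrite <- control_value_ratio in ode.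
    specialize (r_lt1 x_lt).
    split.
    + exists (ratio x), 0. rewrite Rminus_0_r. repeat split; lra.
    + intros y (u & xi & u01 & xi_x & ->).
      pose proof (control_value_le_ratio x u).
      pose proof (jump_le_left x xi ltac:(lra) ltac:(lra)). nra.
  - specialize (r_ge1 ltac:(lra)).
    assert (E1 : control_value x 1 = sigma ^ 2 / 2 * D2V x + eta * DV x)
      by (unfold control_value; field).
    destruct (Rle_dec x b) as [x_le | x_gt].
    + pose proof (ode_middle x ltac:(lra)) as ode. rewrite <- E1 in ode.
      split.
      * exists 1, 0. rewrite Rminus_0_r. repeat split; lra.
      * intros y (u & xi & u01 & xi_x & ->).
        pose proof (control_value_le_1 x u u01 r_ge1).
        pose proof (jump_le_left x xi ltac:(lra) ltac:(lra)). nra.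
    + pose proof (ode_right x ltac:(lra)) as ode. rewrite <- E1 in ode.
      split.
      * exists 1, (x - b). replace (x - (x - b)) with b by ring.
        repeat split; lra.
      * intros y (u & xi & u01 & xi_x & ->).
        pose proof (control_value_le_1 x u u01 r_ge1).
        pose proof (jump_le_right x xi). nra.
Qed.

Context (v : R -> R) (vV : forall x, 0 <= x -> v x = V x).

Lemma locally_v (x : R) : 0 < x -> locally x (fun y => V y = v y).
Proof.
  intros x_gt0. apply filter_imp with (2 := locally_gt x 0 x_gt0).
  intros y y_gt0. rewrite vV; lra.
Qed.

Lemma is_derive_v (x : R) : 0 < x -> is_derive v x (DV x).
Proof.
  intros x_gt0. apply is_derive_ext_loc with V; [apply locally_v, x_gt0 | apply dV].
Qed.

Lemma locally_Dv (x : R) : 0 < x -> locally x (fun y => DV y = Derive v y).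
Proof.
  intros x_gt0. apply filter_imp with (2 := locally_gt x 0 x_gt0).
  intros y y_gt0. symmetry. apply is_derive_unique, is_derive_v, y_gt0.
Qed.

Lemma Derive_v (x : R) : 0 < x -> Derive v x = DV x.
Proof. intros x_gt0. apply is_derive_unique, is_derive_v, x_gt0. Qed.

Lemma is_derive_Dv (x : R) : 0 < x -> is_derive (Derive v) x (D2V x).
Proof.
  intros x_gt0.
  apply is_derive_ext_loc with DV; [apply locally_Dv, x_gt0 | apply dDV].
Qed.

Lemma Derive2_v (x : R) : 0 < x -> Derive_n v 2 x = D2V x.
Proof. intros x_gt0. apply is_derive_unique, is_derive_Dv, x_gt0. Qed.

(** [V] is smooth on all of [R], so the limit at [0] is a plain value; [v] has to agree with it only
    on the half-line, and its derivatives at [x > 0] follow by locality. *)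
Lemma verification :
  Glb_Rbar (fun x => 0 < x /\ Derive v x < 1) = Finite b /\
  C2_on Rgt0 v /\
  increasing_on Rgt0 v /\
  concave_on Rgt0 v /\
  HJB_solution mu eta sigma delta gamma v /\
  (forall x, 0 < x -> Derive_n v 2 x <> 0) /\
  decreasing_on Rgt0 (fun x => Derive v x / Derive_n v 2 x) /\
  (exists l : R,
     filterlim (fun x => mu / sigma ^ 2 * (Derive v x / Derive_n v 2 x))
       (at_right 0) (locally l) /\
     -1 < l) /\
  Glb_Rbar (fun x => 0 < x /\
     1 <= - (mu / sigma ^ 2) * (Derive v x / Derive_n v 2 x))
    = Finite xb.
Proof.
  split; [|split; [|split; [|split; [|split; [|split; [|split; [|split]]]]]]].
  - apply Glb_Rbar_ray.
    + intros x [x_gt0 H]. rewrite Derive_v in H by auto.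
      destruct (Rle_dec b x); auto.
      pose proof (DV_ge1 x ltac:(lra)). lra.
    + intros x bx. split; [lra|]. rewrite Derive_v, <- DV_b by lra.
      apply DV_decreasing, bx.
  - intros x x_gt0. split; [|split].
    + exists (DV x). apply is_derive_v, x_gt0.
    + exists (D2V x). apply is_derive_Dv, x_gt0.
    + apply continuous_ext_loc with D2V; [|apply cD2V].
      apply filter_imp with (2 := locally_gt x 0 x_gt0).
      intros y y_gt0. symmetry. apply Derive2_v, y_gt0.
  - unfold Rgt0. intros x y x_gt0 y_gt0 xy. rewrite !vV by lra.
    apply is_derive_positive_increasing with DV; auto.
  - unfold Rgt0. intros x y t x_gt0 y_gt0 t01.
    assert (z_gt0 : 0 <= t * x + (1 - t) * y) by nra.
    rewrite !vV by lra.
    (* Averaging the tangent bounds at [z] cancels the linear terms. *)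
    set (z := t * x + (1 - t) * y).
    pose proof (tangent_above z x) as Hx. pose proof (tangent_above z y) as Hy.
    apply (Rmult_le_compat_l t) in Hx; [|lra].
    apply (Rmult_le_compat_l (1 - t)) in Hy; [|lra].
    assert (E : t * (V z + DV z * (x - z)) + (1 - t) * (V z + DV z * (y - z)) = V z)
      by (unfold z; ring).
    lra.
  - split; [rewrite vV; lra|]. intros x x_gt0.
    destruct (hamiltonian_is_max x x_gt0) as [(u & xi & u01 & xi_x & E) H].
    split.
    + exists u, xi. repeat split; try lra.
      unfold hamiltonian. rewrite Derive2_v, Derive_v, !vV by lra. exact E.
    + intros y (u' & xi' & u01' & xi_x' & ->). apply H. exists u', xi'.
      repeat split; try lra.
      unfold hamiltonian. rewrite Derive2_v, Derive_v, !vV by lra. reflexivity.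
  - intros x x_gt0. rewrite Derive2_v by auto. specialize (D2V_lt0 x); lra.
  - unfold Rgt0. intros x y x_gt0 y_gt0 xy.
    rewrite !Derive2_v, !Derive_v by auto. auto.
  (* [DV] and [D2V] are continuous at [0], and [0 < xb] makes the value exceed -1 by
     [ratio_sign]. *)
  - exists (mu / sigma ^ 2 * (DV 0 / D2V 0)). split.
    + apply filterlim_ext_loc with (fun x => mu / sigma ^ 2 * (DV x / D2V x)).
      { exists (mkposreal 1 Rlt_0_1). intros y _ y_gt0.
        rewrite Derive_v, Derive2_v; auto. }
      apply (filterlim_filter_le_1 _ (filter_le_within _)).
      change (continuous (fun x => mu / sigma ^ 2 * (DV x / D2V x)) 0).
      apply (continuous_mult (fun _ => mu / sigma ^ 2)); [apply continuous_const|].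
      apply (continuous_mult DV (fun x => / D2V x)).
      * apply @ex_derive_continuous. exists (D2V 0). apply dDV.
      * apply continuous_comp; [apply cD2V|].
        apply continuous_Rinv. specialize (D2V_lt0 0); lra.
    + destruct (ratio_sign 0) as [H _]. specialize (H xb_gt0). lra.
  - apply Glb_Rbar_ray.
    + intros x [x_gt0 H]. rewrite Derive_v, Derive2_v in H by auto.
      destruct (Rle_dec xb x); auto.
      destruct (ratio_sign x) as [H' _]. specialize (H' ltac:(lra)). lra.
    + intros x bx. split; [lra|]. rewrite Derive_v, Derive2_v by lra.
      apply ratio_sign; lra.
Qed.

End Verification.

(** * Characteristic roots, [f1] and [h2] *)

Section Roots.

Context (eta sigma : R) (eta_gt0 : 0 < eta) (sigma_gt0 : 0 < sigma).

Lemma roots_spec (q : R) : 0 < q ->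
  (neg_root eta sigma q < 0 /\ char_poly eta sigma q (neg_root eta sigma q) = 0) /\
  (0 < pos_root eta sigma q /\ char_poly eta sigma q (pos_root eta sigma q) = 0).
Proof.
  intros q_gt0.
  assert (s2 : 0 < sigma ^ 2) by (apply pow_lt; lra).
  set (D := sqrt (eta ^ 2 + 2 * sigma ^ 2 * q)).
  assert (DD : D * D = eta ^ 2 + 2 * sigma ^ 2 * q) by (apply sqrt_sqrt; nra).
  assert (D_gt : eta < D).
  { assert (0 <= D) by apply sqrt_pos. nra. }
  split;
    [apply (the_spec (fun r => r < 0 /\ char_poly eta sigma q r = 0))
    |apply (the_spec (fun r => 0 < r /\ char_poly eta sigma q r = 0))].
  - exists ((- eta - D) / sigma ^ 2). split.
    + apply Rdiv_neg_pos; lra.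
    + unfold char_poly.
      replace (sigma ^ 2 / 2 * ((- eta - D) / sigma ^ 2) ^ 2
                + eta * ((- eta - D) / sigma ^ 2) - q)
        with ((D * D - eta ^ 2 - 2 * sigma ^ 2 * q) / (2 * sigma ^ 2))
        by (field; lra).
      rewrite DD. field; lra.
  - exists ((- eta + D) / sigma ^ 2). split.
    + apply Rdiv_lt_0_compat; lra.
    + unfold char_poly.
      replace (sigma ^ 2 / 2 * ((- eta + D) / sigma ^ 2) ^ 2
                + eta * ((- eta + D) / sigma ^ 2) - q)
        with ((D * D - eta ^ 2 - 2 * sigma ^ 2 * q) / (2 * sigma ^ 2))
        by (field; lra).
      rewrite DD. field; lra.
Qed.

(** The equation reads [r * (sigma ^ 2 * r + 2 * eta) = 2 * q > 0] with [r < 0]. *)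
Lemma neg_root_bound (q r : R) :
  0 < q -> r < 0 -> char_poly eta sigma q r = 0 -> sigma ^ 2 * r + 2 * eta < 0.
Proof. unfold char_poly. nra. Qed.

(** The difference of the two equations factors through [n - r], and the cofactor is negative by
    [neg_root_bound]. *)
Lemma neg_root_unique (q r : R) :
  0 < q -> r < 0 -> char_poly eta sigma q r = 0 -> neg_root eta sigma q = r.
Proof.
  intros q_gt0 r_lt0 Er. destruct (roots_spec q q_gt0) as [[n_lt0 En] _].
  pose proof (neg_root_bound q r q_gt0 r_lt0 Er).
  pose proof (neg_root_bound q _ q_gt0 n_lt0 En).
  set (n := neg_root eta sigma q) in *. unfold char_poly in *.
  assert ((n - r) * (sigma ^ 2 * n + 2 * eta + sigma ^ 2 * r) = 0) by lra.
  pose proof (pow_lt sigma 2 sigma_gt0). nra.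
Qed.

End Roots.

(** * Monotonicity of [f1], the value [gamma1], and the shape of [h2] *)

Section Barrier.

Context (mu eta sigma delta : R) (eta_gt0 : 0 < eta) (sigma_gt0 : 0 < sigma)
  (delta_gt0 : 0 < delta) (eta_lt_mu : eta < mu) (mu_lt_2eta : mu < 2 * eta).

Let lam := lambda eta sigma delta.
Let f := f1 eta sigma delta.
Let T := (2 * eta - mu) / (2 * delta).

Lemma lambda_spec (gamma : R) : 0 < gamma ->
  lam gamma < 0 /\ sigma ^ 2 * lam gamma + 2 * eta < 0 /\
  sigma ^ 2 / 2 * lam gamma ^ 2 + eta * lam gamma = delta + gamma.
Proof.
  intros gamma_gt0.
  destruct (roots_spec eta sigma eta_gt0 sigma_gt0 (delta + gamma)) as [[H1 H2] _]; [lra|].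
  change (neg_root eta sigma (delta + gamma)) with (lam gamma) in H1, H2.
  repeat split; auto.
  - apply neg_root_bound with (delta + gamma); auto; lra.
  - unfold char_poly in H2; lra.
Qed.

(** The characteristic equation eliminates [gamma] outside [lam gamma], leaving a rational function
    of the root. *)
Lemma f1_lambda (gamma : R) : 0 < gamma ->
  f gamma = eta / delta + sigma ^ 2 / (sigma ^ 2 * lam gamma + 2 * eta).
Proof.
  intros gamma_gt0. destruct (lambda_spec gamma gamma_gt0) as (H1 & H2 & H3).
  unfold f, f1. fold lam.
  replace (delta + gamma) with (sigma ^ 2 / 2 * lam gamma ^ 2 + eta * lam gamma) by lra.
  (* The first two occurrences are arguments of [lam]. *)
  replace gamma with (sigma ^ 2 / 2 * lam gamma ^ 2 + eta * lam gamma - delta) at 3 by lra.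
  field. repeat split; lra.
Qed.

Lemma lambda_decreasing (g g' : R) : 0 < g -> g < g' -> lam g' < lam g.
Proof.
  intros g_gt0 gg'.
  destruct (lambda_spec g ltac:(lra)) as (H1 & H2 & H3).
  destruct (lambda_spec g' ltac:(lra)) as (H1' & H2' & H3').
  pose proof (pow_lt sigma 2 sigma_gt0).
  assert ((lam g' - lam g) * (sigma ^ 2 * lam g + 2 * eta + sigma ^ 2 * lam g') > 0)
    by nra.
  nra.
Qed.

(** In [f1_lambda] the denominator is negative and decreases with [gamma], so its reciprocal
    increases. *)
Lemma f1_increasing (g g' : R) : 0 < g -> g < g' -> f g < f g'.
Proof.
  intros g_gt0 gg'. rewrite !f1_lambda by lra.
  destruct (lambda_spec g ltac:(lra)) as (H1 & H2 & H3).
  destruct (lambda_spec g' ltac:(lra)) as (H1' & H2' & H3').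
  pose proof (pow_lt sigma 2 sigma_gt0).
  apply Rplus_lt_compat_l, Rmult_lt_compat_l; [lra|].
  pose proof (lambda_decreasing g g' g_gt0 gg').
  apply Ropp_lt_cancel. rewrite <- !Rinv_opp.
  apply Rinv_lt_contravar; nra.
Qed.

Lemma f1_lt (gamma : R) : 0 < gamma -> f gamma < eta / delta.
Proof.
  intros gamma_gt0. rewrite f1_lambda by lra.
  destruct (lambda_spec gamma gamma_gt0) as (H1 & H2 & H3).
  assert (sigma ^ 2 / (sigma ^ 2 * lam gamma + 2 * eta) < 0); [|lra].
  apply Rdiv_pos_neg; auto. apply pow_lt; lra.
Qed.

Lemma gamma1_spec :
  0 < gamma1 mu eta sigma delta /\ f (gamma1 mu eta sigma delta) = T.
Proof.
  apply (the_spec (fun x => Rgt0 x /\ f x = T)).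
  (* By [f1_lambda], [f = T] means [sigma ^ 2 * lam + 2 * eta = - 2 * delta * sigma ^ 2 / mu].
     Solving for [lam] and inserting it in the characteristic equation gives this [gamma]. *)
  exists (delta * (2 * delta * sigma ^ 2 / mu ^ 2 + (2 * eta - mu) / mu)).
  assert (pos : 0 < delta * (2 * delta * sigma ^ 2 / mu ^ 2 + (2 * eta - mu) / mu)).
  { apply Rmult_lt_0_compat; [lra|]. apply Rplus_lt_0_compat.
    - repeat (apply Rmult_lt_0_compat || apply Rinv_0_lt_compat || apply pow_lt); lra.
    - apply Rdiv_lt_0_compat; lra. }
  split; [exact pos|].
  rewrite f1_lambda by exact pos.
  assert (E : lam (delta * (2 * delta * sigma ^ 2 / mu ^ 2 + (2 * eta - mu) / mu))
              = - (2 * delta / mu) - 2 * eta / sigma ^ 2).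
  { apply neg_root_unique; auto; [lra | |].
    - assert (0 < 2 * delta / mu) by (apply Rdiv_lt_0_compat; lra).
      assert (0 < 2 * eta / sigma ^ 2)
        by (apply Rdiv_lt_0_compat; [lra | apply pow_lt; lra]).
      lra.
    - unfold char_poly. field; lra. }
  rewrite E. unfold T. field. repeat split; try lra.
  assert (0 < sigma ^ 2 * delta) by (apply Rmult_lt_0_compat; [apply pow_lt|]; lra).
  nra.
Qed.

Lemma f1_gt (gamma : R) : gamma1 mu eta sigma delta < gamma -> T < f gamma.
Proof.
  destruct gamma1_spec as [H1 H2]. intros H. rewrite <- H2.
  apply f1_increasing; auto.
Qed.

Let tp := theta_plus eta sigma delta.
Let tm := theta_minus eta sigma delta.
Let al := a1 mu eta sigma delta.
Let am := a2 mu eta sigma delta.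

Lemma theta_spec :
  0 < tp /\ tm < 0 /\ sigma ^ 2 / 2 * tp ^ 2 + eta * tp = delta /\
  sigma ^ 2 / 2 * tm ^ 2 + eta * tm = delta.
Proof.
  destruct (roots_spec eta sigma eta_gt0 sigma_gt0 delta delta_gt0)
    as [[H1 H2] [H3 H4]].
  change (neg_root eta sigma delta) with tm in H1, H2.
  change (pos_root eta sigma delta) with tp in H3, H4.
  unfold char_poly in *. repeat split; auto; lra.
Qed.

Lemma T_gt0 : 0 < T.
Proof. apply Rdiv_lt_0_compat; lra. Qed.

(** For [am] the point is [tp * T < 1]: the equation of [tp] gives [eta * tp < delta], while
    [delta * T = eta - mu / 2 < eta]. *)
Lemma a1_a2_gt0 : 0 < al /\ 0 < am.
Proof.
  destruct theta_spec as (H1 & H2 & H3 & H4). pose proof T_gt0.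
  unfold al, am, a1, a2. fold tp tm T. split; [nra|].
  assert (eta * tp < delta).
  { assert (0 < sigma ^ 2 / 2 * tp ^ 2); [|lra].
    apply Rmult_lt_0_compat; [pose proof (pow_lt sigma 2 sigma_gt0); lra|].
    apply pow_lt, H1. }
  assert (ET : delta * T = eta - mu / 2) by (unfold T; field; lra).
  assert (0 < delta * (1 - tp * T)); [|nra].
  replace (delta * (1 - tp * T)) with (delta - tp * (delta * T)) by ring.
  rewrite ET. nra.
Qed.

(* The [n]-th derivative of [h2]. *)
Definition h2n (n : nat) (x : R) : R :=
  1 / (tp - tm) * (al * tp ^ n * exp (tp * x) - am * tm ^ n * exp (tm * x)).

Lemma h2_h2n (x : R) : h2 mu eta sigma delta x = h2n 0 x.
Proof. unfold h2, h2n. fold tp tm al am. simpl. f_equal. ring. Qed.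

Lemma is_derive_h2n (n : nat) (x : R) : is_derive (h2n n) x (h2n (S n) x).
Proof.
  unfold h2n. auto_derive; [trivial|]. simpl. ring.
Qed.

Lemma Derive_h2 (x : R) : Derive (h2 mu eta sigma delta) x = h2n 1 x.
Proof.
  rewrite (Derive_ext _ (h2n 0) x h2_h2n). apply is_derive_unique, is_derive_h2n.
Qed.

Lemma h2_ode (x : R) :
  sigma ^ 2 / 2 * h2n 2 x + eta * h2n 1 x - delta * h2n 0 x = 0.
Proof.
  destruct theta_spec as (H1 & H2 & H3 & H4).
  unfold h2n.
  replace (sigma ^ 2 / 2 * (1 / (tp - tm) * (al * tp ^ 2 * exp (tp * x) - am * tm ^ 2 * exp (tm * x)))
    + eta * (1 / (tp - tm) * (al * tp ^ 1 * exp (tp * x) - am * tm ^ 1 * exp (tm * x)))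
    - delta * (1 / (tp - tm) * (al * tp ^ 0 * exp (tp * x) - am * tm ^ 0 * exp (tm * x))))
   with (1 / (tp - tm) *
     (al * exp (tp * x) * (sigma ^ 2 / 2 * tp ^ 2 + eta * tp - delta)
      - am * exp (tm * x) * (sigma ^ 2 / 2 * tm ^ 2 + eta * tm - delta))).
  - rewrite H3, H4. ring.
  - simpl. ring.
Qed.

(** The coefficients [a1] and [a2] encode the first two values; the ODE then yields the third. The
    resulting ratio [- sigma ^ 2 / mu] is the one at which the vertex in [u] equals 1. *)
Lemma h2n_0 : h2n 0 0 = T /\ h2n 1 0 = 1 /\ h2n 2 0 = - (mu / sigma ^ 2).
Proof.
  destruct theta_spec as (H1 & H2 & H3 & H4).
  assert (E0 : h2n 0 0 = T).
  { unfold h2n. rewrite !Rmult_0_r, exp_0. unfold al, am, a1, a2.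
    fold tp tm T. field; lra. }
  assert (E1 : h2n 1 0 = 1).
  { unfold h2n. rewrite !Rmult_0_r, exp_0. unfold al, am, a1, a2.
    fold tp tm T. field; lra. }
  repeat split; auto.
  pose proof (h2_ode 0) as H. rewrite E0, E1 in H.
  assert (ET : delta * T = eta - mu / 2) by (unfold T; field; lra).
  assert (s2 : sigma ^ 2 <> 0) by (apply pow_nonzero; lra).
  apply (Rmult_eq_reg_l (sigma ^ 2 / 2)); [|lra].
  replace (sigma ^ 2 / 2 * - (mu / sigma ^ 2)) with (- (mu / 2)) by (field; lra).
  lra.
Qed.

Lemma h2n_1_gt0 (x : R) : 0 < h2n 1 x.
Proof.
  destruct theta_spec as (H1 & H2 & _). destruct a1_a2_gt0 as [Hl Hm].
  unfold h2n. rewrite !pow_1. apply Rmult_lt_0_compat.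
  - apply Rdiv_lt_0_compat; lra.
  - pose proof (exp_pos (tp * x)). pose proof (exp_pos (tm * x)).
    assert (0 < al * tp * exp (tp * x)) by (repeat apply Rmult_lt_0_compat; lra).
    assert (0 < am * - tm * exp (tm * x)) by (repeat apply Rmult_lt_0_compat; lra).
    lra.
Qed.

(** The third derivative is positive, since [tm ^ 3 < 0]. *)
Lemma h2n_2_increasing (x y : R) : x < y -> h2n 2 x < h2n 2 y.
Proof.
  destruct theta_spec as (H1 & H2 & _). destruct a1_a2_gt0 as [Hl Hm].
  apply is_derive_positive_increasing with (h2n 3); [apply is_derive_h2n|].
  intros z. unfold h2n. apply Rmult_lt_0_compat.
  - apply Rdiv_lt_0_compat; lra.
  - pose proof (exp_pos (tp * z)). pose proof (exp_pos (tm * z)).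
    assert (0 < al * tp ^ 3 * exp (tp * z))
      by (repeat apply Rmult_lt_0_compat; try apply pow_lt; lra).
    assert (0 < am * (- tm) ^ 3 * exp (tm * z))
      by (repeat apply Rmult_lt_0_compat; try apply pow_lt; lra).
    lra.
Qed.

Lemma h2n_ratio_decreasing (x y : R) :
  x < y -> h2n 2 y < 0 -> h2n 1 y / h2n 2 y < h2n 1 x / h2n 2 x.
Proof.
  intros xy Dy. pose proof (h2n_2_increasing x y xy).
  destruct theta_spec as (H1 & H2 & _). destruct a1_a2_gt0 as [Hl Hm].
  assert (E : h2n 1 x / h2n 2 x - h2n 1 y / h2n 2 y
     = (h2n 1 x * h2n 2 y - h2n 1 y * h2n 2 x) / (h2n 2 x * h2n 2 y))
    by (field; lra).
  assert (0 < h2n 1 x / h2n 2 x - h2n 1 y / h2n 2 y); [|lra].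
  rewrite E. apply Rdiv_lt_0_compat; [|nra].
  (* In the cross product the terms with [tp] alone or [tm] alone cancel; only mixed exponentials
     remain. *)
  replace (h2n 1 x * h2n 2 y - h2n 1 y * h2n 2 x)
    with (al * am * tp * - tm / (tp - tm)
          * (exp (tm * x + tp * y) - exp (tp * x + tm * y))).
  - apply Rmult_lt_0_compat.
    + apply Rdiv_lt_0_compat; [repeat apply Rmult_lt_0_compat|]; lra.
    + apply Rlt_0_minus, exp_increasing. nra.
  - unfold h2n. rewrite !exp_plus. field. lra.
Qed.

Lemma h2n_2_eventually_ge0 : exists x, 0 < x /\ 0 <= h2n 2 x.
Proof.
  destruct theta_spec as (H1 & H2 & _). destruct a1_a2_gt0 as [Hl Hm].
  set (k := am * tm ^ 2 / (al * tp ^ 2)).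
  assert (tm2 : 0 < tm ^ 2) by nra. assert (tp2 : 0 < tp ^ 2) by nra.
  assert (k_gt0 : 0 < k)
    by (apply Rdiv_lt_0_compat; apply Rmult_lt_0_compat; auto).
  (* The sign of [h2n 2 x] is that of [exp ((tp - tm) * x) - k], and [exp (1 + k) >= 2 + k]. *)
  exists ((1 + k) / (tp - tm)).
  assert (x_gt0 : 0 < (1 + k) / (tp - tm)) by (apply Rdiv_lt_0_compat; lra).
  split; auto.
  set (x := (1 + k) / (tp - tm)) in *.
  unfold h2n. apply Rmult_le_pos; [left; apply Rdiv_lt_0_compat; lra|].
  replace (tp * x) with ((1 + k) + tm * x) by (unfold x; field; lra).
  rewrite exp_plus.
  replace (al * tp ^ 2 * (exp (1 + k) * exp (tm * x)) - am * tm ^ 2 * exp (tm * x))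
    with (al * tp ^ 2 * exp (tm * x) * (exp (1 + k) - k))
    by (unfold k; field; lra).
  pose proof (exp_ineq1_le (1 + k)). pose proof (exp_pos (tm * x)).
  repeat apply Rmult_le_pos; lra.
Qed.

(** Intermediate values for [h2n 0 - y * h2n 1]: it is [T - y < 0] at [0], and where [h2n 2 >= 0]
    the ODE gives [h2n 0 >= eta / delta * h2n 1]. *)
Lemma g2_inverse_spec (y : R) : T < y < eta / delta ->
  let b := inverse_on Rgt0 (g2 mu eta sigma delta) y in
  0 < b /\ h2n 0 b = y * h2n 1 b.
Proof.
  intros [Ty ye] b.
  assert (Hb : Rgt0 b /\ g2 mu eta sigma delta b = y).
  { apply (the_spec (fun x => Rgt0 x /\ g2 mu eta sigma delta x = y)).
    destruct h2n_2_eventually_ge0 as (c & c_gt0 & Hc).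
    destruct h2n_0 as (E0 & E1 & E2).
    destruct (IVT_gen (fun x => h2n 0 x - y * h2n 1 x) 0 c 0) as (x & [x_ge x_le] & Ex).
    - intros x. apply derivable_continuous_pt.
      exists (h2n 1 x - y * h2n 2 x). apply is_derive_Reals.
      apply (is_derive_minus (h2n 0)); [apply is_derive_h2n|].
      apply (is_derive_scal (h2n 1)), is_derive_h2n.
    - rewrite E0, E1. pose proof (h2_ode c) as H. pose proof (h2n_1_gt0 c).
      assert (0 <= h2n 0 c - y * h2n 1 c).
      { assert (0 <= delta * (h2n 0 c - y * h2n 1 c)); [|nra].
        assert (delta * y < eta).
        { replace eta with (delta * (eta / delta)) by (field; lra).
          apply Rmult_lt_compat_l; lra. }
        assert (0 <= sigma ^ 2 / 2 * h2n 2 c)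
          by (apply Rmult_le_pos; [pose proof (pow2_ge_0 sigma)|]; lra).
        nra. }
      rewrite Rmin_left, Rmax_right; lra.
    - rewrite Rmin_left in x_ge by lra. simpl in Ex.
      exists x. split.
      + destruct (Req_dec x 0) as [->|]; [|unfold Rgt0; lra].
        rewrite E0, E1 in Ex. lra.
      + unfold g2. rewrite h2_h2n, Derive_h2. pose proof (h2n_1_gt0 x).
        apply (Rmult_eq_reg_r (h2n 1 x)); [|lra].
        replace (h2n 0 x / h2n 1 x * h2n 1 x) with (h2n 0 x) by (field; lra). lra. }
  destruct Hb as [b_gt0 E]. split; [exact b_gt0|].
  rewrite <- E. unfold g2. rewrite h2_h2n, Derive_h2.
  pose proof (h2n_1_gt0 b). field; lra.
Qed.

End Barrier.

(** * The solution *)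

Section Solution.

Context (mu eta sigma delta gamma : R) (eta_gt0 : 0 < eta) (sigma_gt0 : 0 < sigma)
  (delta_gt0 : 0 < delta) (gamma_gt0 : 0 < gamma)
  (eta_lt_mu : eta < mu) (mu_lt_2eta : mu < 2 * eta).

Let q := eta_bar mu sigma.
Let p := 1 + delta * q.
Let c := c21 mu eta sigma delta.
Let w := c22 mu eta sigma delta.
Let xb := x_bar mu eta sigma delta.

Lemma eta_bar_gt0 : 0 < q.
Proof.
  apply Rdiv_lt_0_compat; [|apply pow_lt; lra].
  apply Rmult_lt_0_compat; [lra | apply pow_lt; lra].
Qed.

Lemma p_gt1 : 1 < p.
Proof. pose proof eta_bar_gt0. unfold p. nra. Qed.

Lemma c21_gt0 : 0 < c.
Proof.
  pose proof p_gt1. pose proof eta_bar_gt0. unfold c, c21. fold q p.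
  apply Rdiv_lt_0_compat; nra.
Qed.

Lemma c22_eq : w = 1 + p * (2 * eta - mu) / (2 * (delta * q) * (mu - eta)).
Proof.
  pose proof eta_bar_gt0. unfold w, c22. fold q. unfold p. field. lra.
Qed.

Lemma c22_gt1 : 1 < w.
Proof.
  pose proof p_gt1. pose proof eta_bar_gt0. rewrite c22_eq.
  assert (0 < p * (2 * eta - mu) / (2 * (delta * q) * (mu - eta))); [|lra].
  assert (0 < delta * q) by nra. apply Rdiv_lt_0_compat; nra.
Qed.

(* [x1] shifted by [M], which makes it independent of [b2]. *)
Definition X (y : R) : R := c * (delta * q / p * (exp (p * y) - 1) + y).
Definition DX (y : R) : R := c * (delta * q * exp (p * y) + 1).
(** Inverting on the whole line lets the left piece be differentiated at [0] and [x_bar] too. *)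
Definition Y : R -> R := inverse_on (fun _ => True) X.

Lemma is_derive_X (y : R) : is_derive X y (DX y).
Proof.
  pose proof p_gt1. unfold X, DX. auto_derive; [trivial|]. field. lra.
Qed.

Lemma DX_ge (y : R) : c <= DX y.
Proof.
  pose proof c21_gt0. pose proof eta_bar_gt0. unfold DX.
  pose proof (exp_pos (p * y)).
  assert (0 < delta * q) by nra.
  assert (0 < delta * q * exp (p * y)) by nra.
  nra.
Qed.

Lemma DX_increasing (x y : R) : x < y -> DX x < DX y.
Proof.
  intros xy. pose proof c21_gt0. pose proof eta_bar_gt0. pose proof p_gt1. unfold DX.
  apply Rmult_lt_compat_l; auto. apply Rplus_lt_compat_r, Rmult_lt_compat_l.
  - apply Rmult_lt_0_compat; lra.
  - apply exp_increasing, Rmult_lt_compat_l; lra.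
Qed.

Lemma X_increasing (x y : R) : x < y -> X x < X y.
Proof.
  apply is_derive_positive_increasing with DX; [apply is_derive_X|].
  intros z. pose proof c21_gt0. pose proof (DX_ge z). lra.
Qed.

Lemma X_injective (x y : R) : X x = X y -> x = y.
Proof.
  intros E. destruct (Rtotal_order x y) as [H | [H | H]]; auto;
    apply X_increasing in H; lra.
Qed.

Lemma X_0 : X 0 = 0.
Proof. unfold X. rewrite Rmult_0_r, exp_0. ring. Qed.

Lemma X_Y (x : R) : X (Y x) = x.
Proof.
  pose proof c21_gt0 as c_gt0. pose proof eta_bar_gt0. pose proof p_gt1.
  apply (the_spec (fun y => True /\ X y = x)).
  assert (k_gt0 : 0 < delta * q / p) by (apply Rdiv_lt_0_compat; nra).
  (* [X (x / c)] lies beyond [x] as seen from [0], because the exponential term has the sign of [x];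
     so [0] and [x / c] bracket a solution. *)
  assert (Xc : X (x / c) = c * (delta * q / p) * (exp (p * (x / c)) - 1) + x)
    by (unfold X; field; lra).
  destruct (IVT_gen X 0 (x / c) x) as (y & _ & E); [| |exists y; auto].
  - intros z. apply derivable_continuous_pt. exists (DX z).
    apply is_derive_Reals, is_derive_X.
  - rewrite X_0. pose proof (exp_ineq1_le (p * (x / c))).
    assert (ck : 0 < c * (delta * q / p)) by (apply Rmult_lt_0_compat; auto).
    destruct (Rle_dec 0 x) as [x_ge0 | x_lt0].
    + assert (0 <= p * (x / c)).
      { apply Rmult_le_pos; [lra|]. apply Rdiv_le_0_compat; lra. }
      assert (0 <= c * (delta * q / p) * (exp (p * (x / c)) - 1))
        by (apply Rmult_le_pos; lra).
      rewrite Rmin_left, Rmax_right; lra.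
    + assert (0 < p * (- x / c)).
      { apply Rmult_lt_0_compat; [lra|]. apply Rdiv_lt_0_compat; lra. }
      assert (exp (p * (x / c)) < 1).
      { rewrite <- exp_0. apply exp_increasing. lra. }
      assert (0 < c * (delta * q / p) * (1 - exp (p * (x / c))))
        by (apply Rmult_lt_0_compat; lra).
      rewrite Rmin_right, Rmax_left; lra.
Qed.

Lemma Y_X (y : R) : Y (X y) = y.
Proof. apply X_injective, X_Y. Qed.

Lemma Y_increasing (x y : R) : x < y -> Y x < Y y.
Proof.
  intros xy. destruct (Rlt_dec (Y x) (Y y)) as [|n]; auto.
  destruct (Req_dec (Y x) (Y y)) as [E|].
  - apply (f_equal X) in E. rewrite !X_Y in E. lra.
  - assert (Y y < Y x) as H' by lra. apply X_increasing in H'.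
    rewrite !X_Y in H'. lra.
Qed.

Lemma Y_le (x y : R) : x <= y -> Y x <= Y y.
Proof.
  intros [xy | ->]; [|lra]. left. now apply Y_increasing.
Qed.

Lemma is_derive_Y (x : R) : is_derive Y x (/ DX (Y x)).
Proof.
  apply (is_derive_global_inverse X DX Y c c21_gt0 is_derive_X DX_ge X_Y).
Qed.

Lemma X_c22 : X (ln w / p) = xb.
Proof.
  pose proof p_gt1. pose proof c22_gt1. pose proof eta_bar_gt0.
  unfold X, xb, x_bar. fold c w q p.
  replace (p * (ln w / p)) with (ln w) by (field; lra).
  rewrite exp_ln by lra.
  assert (E : c * (delta * q / p) * (w - 1) = q * (2 * eta - mu) / (2 * p)).
  { rewrite c22_eq. unfold c, c21. fold q p. field. lra. }
  rewrite <- E. field. lra.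
Qed.

Lemma Y_xb : Y xb = ln w / p.
Proof. rewrite <- X_c22. apply Y_X. Qed.

Lemma x_bar_gt0 : 0 < xb.
Proof.
  rewrite <- X_c22, <- X_0. apply X_increasing.
  pose proof p_gt1. apply Rdiv_lt_0_compat; [|lra].
  rewrite <- ln_1. apply ln_increasing; [lra | apply c22_gt1].
Qed.

(** This is the role of [c22]: since [v' / v''] is [- DX (Y x)] on the left, the vertex in [u]
    reaches 1 at [x_bar]. *)
Lemma DX_xb : DX (Y xb) = sigma ^ 2 / mu.
Proof.
  pose proof p_gt1. pose proof c22_gt1. pose proof eta_bar_gt0.
  rewrite Y_xb. unfold DX.
  replace (p * (ln w / p)) with (ln w) by (field; lra).
  rewrite exp_ln, c22_eq by lra.
  unfold c, c21. fold q p.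
  replace (sigma ^ 2 / mu) with (q * mu / 2) by (unfold q, eta_bar; field; lra).
  unfold p; field. unfold p in *; lra.
Qed.

Lemma x1_X (b2 z : R) :
  x1 mu eta sigma delta gamma b2 z = X (z + M mu eta sigma delta gamma b2).
Proof.
  pose proof p_gt1. unfold x1, X. fold c q p. field. lra.
Qed.

(** The endpoints [- M] and [z_bar] are [Y 0 - M] and [Y xb - M], so [Y x - M] is in range;
    injectivity of [X] identifies it with the chosen inverse. *)
Lemma x1_inv_Y (b2 x : R) : 0 <= x <= xb ->
  x1_inv mu eta sigma delta gamma b2 x = Y x - M mu eta sigma delta gamma b2.
Proof.
  intros Hx. set (m := M mu eta sigma delta gamma b2).
  destruct (the_spec (fun z => (- m <= z <= z_bar mu eta sigma delta gamma b2)
              /\ x1 mu eta sigma delta gamma b2 z = x)) as [_ E].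
  - exists (Y x - m). rewrite x1_X. fold m.
    replace (Y x - m + m) with (Y x) by ring. split; [|apply X_Y].
    unfold z_bar. fold m w q p. rewrite <- Y_xb.
    assert (0 <= Y x <= Y xb); [|lra].
    rewrite <- (Y_X 0), X_0.
    split; apply Y_le; lra.
  - rewrite x1_X in E. fold m in E.
    assert (X (Y x) = x) as E' by apply X_Y.
    rewrite <- E in E' at 2. apply X_injective in E'.
    unfold x1_inv, inverse_on. fold m. lra.
Qed.

Section LeftPiece.

Context (E : R) (E_gt0 : 0 < E).

(** With [E = exp M] this is the left formula of the candidate after [x1_inv_Y]; then
    [L1 = exp (- z)] for [z = Y x - M]. *)
Definition L0 (x : R) : R := c * E * exp (- Y x) * (exp (p * Y x) - 1).
Definition L1 (x : R) : R := E * exp (- Y x).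
Definition L2 (x : R) : R := - (E * exp (- Y x) / DX (Y x)).

Lemma DX_gt0 (y : R) : 0 < DX y.
Proof. pose proof c21_gt0. pose proof (DX_ge y). lra. Qed.

(** In the variable [y = Y x] the derivative is [E * exp (- y) * DX y], and the chain rule divides
    by [DX y]. *)
Lemma is_derive_L0 (x : R) : is_derive L0 x (L1 x).
Proof.
  pose proof (DX_gt0 (Y x)).
  replace (L1 x) with (scal (/ DX (Y x)) (E * exp (- Y x) * DX (Y x)))
    by (unfold L1, scal; simpl; unfold mult; simpl; field; lra).
  apply (is_derive_comp (fun y => c * E * exp (- y) * (exp (p * y) - 1)) Y);
    [|apply is_derive_Y].
  auto_derive; [trivial|].
  unfold DX. replace (delta * q) with (p - 1) by (unfold p; ring). ring.
Qed.

Lemma is_derive_L1 (x : R) : is_derive L1 x (L2 x).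
Proof.
  pose proof (DX_gt0 (Y x)).
  replace (L2 x) with (scal (/ DX (Y x)) (- (E * exp (- Y x))))
    by (unfold L2, scal; simpl; unfold mult; simpl; field; lra).
  apply (is_derive_comp (fun y => E * exp (- y)) Y); [|apply is_derive_Y].
  auto_derive; [trivial|]. ring.
Qed.

Lemma continuous_L2 (x : R) : continuous L2 x.
Proof.
  apply (continuous_comp Y (fun y => - (E * exp (- y) / DX y))).
  - apply @ex_derive_continuous. exists (/ DX (Y x)). apply is_derive_Y.
  - apply @ex_derive_continuous. pose proof (DX_gt0 (Y x)) as H.
    unfold DX in *. auto_derive. lra.
Qed.

Lemma L1_gt0 (x : R) : 0 < L1 x.
Proof. apply Rmult_lt_0_compat; [auto | apply exp_pos]. Qed.

Lemma L2_lt0 (x : R) : L2 x < 0.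
Proof.
  apply Ropp_lt_gt_0_contravar, Rdiv_lt_0_compat; [apply L1_gt0 | apply DX_gt0].
Qed.

Lemma L_ratio (x : R) : L1 x / L2 x = - DX (Y x).
Proof.
  unfold L1, L2. pose proof (DX_gt0 (Y x)). pose proof (exp_pos (- Y x)).
  field. lra.
Qed.

(** After division by [L1] both sides are affine in [exp (p * Y x)]; matching the constant terms is
    the definition of [c21]. *)
Lemma L_ode (x : R) :
  - (mu ^ 2 / (2 * sigma ^ 2)) * (L1 x ^ 2 / L2 x)
  - (mu - eta) * L1 x - delta * L0 x = 0.
Proof.
  pose proof p_gt1. pose proof eta_bar_gt0.
  replace (L1 x ^ 2 / L2 x) with (L1 x * (L1 x / L2 x)).
  2: { pose proof (L2_lt0 x). field. lra. }
  rewrite L_ratio.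
  replace (mu ^ 2 / (2 * sigma ^ 2)) with (/ q) by (unfold q, eta_bar; field; lra).
  unfold L0, L1, DX. unfold c, c21. fold q p.
  unfold p in *. field. lra.
Qed.

End LeftPiece.

End Solution.

(** * Matching the three pieces at [x_bar] and [b2] *)

Section Pasting.

Context (mu eta sigma delta gamma : R) (eta_gt0 : 0 < eta) (sigma_gt0 : 0 < sigma)
  (delta_gt0 : 0 < delta) (gamma_gt0 : 0 < gamma)
  (eta_lt_mu : eta < mu) (mu_lt_2eta : mu < 2 * eta)
  (gamma1_lt_gamma : gamma1 mu eta sigma delta < gamma).

Let xb := x_bar mu eta sigma delta.
Let b := b2_gamma mu eta sigma delta gamma.
Let bb := inverse_on Rgt0 (g2 mu eta sigma delta) (f1 eta sigma delta gamma).
Let lam := lambda eta sigma delta gamma.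
Let Mb := M mu eta sigma delta gamma b.
Let A := exp Mb * kappa mu eta sigma delta.
Let h := h2n mu eta sigma delta.
Let p := 1 + delta * eta_bar mu sigma.
Let y0 := Y mu eta sigma delta.

(** The equation [g2 bb = f1 gamma] with denominators cleared. *)
Lemma bb_spec :
  0 < bb /\
  lam * delta * h 0%nat bb
    = (delta + lam * eta * gamma / (delta + gamma)) * h 1%nat bb.
Proof.
  destruct (g2_inverse_spec mu eta sigma delta eta_gt0 sigma_gt0 delta_gt0
              eta_lt_mu mu_lt_2eta (f1 eta sigma delta gamma)) as [H1 H2].
  - split; [now apply f1_gt | now apply f1_lt].
  - split; [exact H1|]. fold bb h in H2. rewrite H2.
    destruct (lambda_spec eta sigma delta eta_gt0 sigma_gt0 delta_gt0 gamma gamma_gt0)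
      as [Hl _]. fold lam in Hl.
    unfold f1. fold lam. field. lra.
Qed.

Lemma h1_gt0 (x : R) : 0 < h 1%nat x.
Proof. now apply h2n_1_gt0. Qed.

Lemma lam_spec : lam < 0 /\ sigma ^ 2 / 2 * lam ^ 2 + eta * lam = delta + gamma.
Proof.
  destruct (lambda_spec eta sigma delta eta_gt0 sigma_gt0 delta_gt0 gamma gamma_gt0)
    as (H1 & _ & H2). auto.
Qed.

(** Hence [A] is the slope of the left piece at [x_bar], as the scale of a multiple of [h2] with
    unit initial slope must be. *)
Lemma kappa_Y : kappa mu eta sigma delta = exp (- y0 xb).
Proof.
  unfold kappa, Rpower. f_equal.
  unfold y0, xb. rewrite Y_xb by auto. fold p.
  pose proof (p_gt1 mu eta sigma delta) as Hp. fold p in Hp.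
  field. specialize (Hp ltac:(auto) ltac:(auto) ltac:(auto) ltac:(auto)). lra.
Qed.

Lemma b_minus_xb : b - xb = bb.
Proof. unfold b, b2_gamma. fold xb bb. ring. Qed.

Lemma A_gt0 : 0 < A.
Proof. apply Rmult_lt_0_compat; [|rewrite kappa_Y]; apply exp_pos. Qed.

(* [M] is chosen so that [v'] is continuous at [b2]; the choice of [b2] then
   makes the common value [1]. *)
Lemma A_h1 : A * h 1%nat bb = 1.
Proof.
  destruct lam_spec as [l_lt0 _]. destruct bb_spec as [_ E].
  pose proof (h1_gt0 bb) as h1.
  assert (k_gt0 : 0 < kappa mu eta sigma delta) by (rewrite kappa_Y; apply exp_pos).
  unfold A, Mb, M. fold xb. rewrite b_minus_xb. unfold lam in E.
  rewrite Derive_h2, h2_h2n. fold h. fold lam in E. fold lam.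
  set (N := gamma / (gamma + delta) - lam * eta * gamma / (delta + gamma) ^ 2).
  assert (N_gt0 : 0 < N).
  { assert (0 < gamma / (gamma + delta)) by (apply Rdiv_lt_0_compat; lra).
    assert (0 < - lam * eta * gamma / (delta + gamma) ^ 2).
    { apply Rdiv_lt_0_compat; [|apply pow_lt; lra].
      repeat apply Rmult_lt_0_compat; lra. }
    unfold N. lra. }
  replace (h 1%nat bb - lam * delta / (delta + gamma) * h 0%nat bb)
    with (h 1%nat bb - (lam * delta * h 0%nat bb) / (delta + gamma)) by (field; lra).
  rewrite E.
  (* The factor [N] is also the numerator inside [M], so it cancels. *)
  replace (h 1%nat bb - (delta + lam * eta * gamma / (delta + gamma)) * h 1%nat bb
             / (delta + gamma)) with (h 1%nat bb * N) by (unfold N; field; lra).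
  rewrite exp_ln.
  - field. lra.
  - apply Rdiv_lt_0_compat; auto.
    apply Rmult_lt_0_compat; [|apply Rmult_lt_0_compat]; auto.
Qed.

Lemma A_h0 :
  A * h 0%nat bb = 1 / lam + eta * gamma / (delta * (delta + gamma)).
Proof.
  destruct lam_spec as [l_lt0 _]. destruct bb_spec as [_ E].
  apply (Rmult_eq_reg_l (lam * delta)); [|nra].
  replace (lam * delta * (A * h 0%nat bb)) with (A * (lam * delta * h 0%nat bb)) by ring.
  rewrite E.
  replace (A * ((delta + lam * eta * gamma / (delta + gamma)) * h 1%nat bb))
    with ((A * h 1%nat bb) * (delta + lam * eta * gamma / (delta + gamma))) by ring.
  rewrite A_h1. field. lra.
Qed.

(** From the ODE of [h2] and the two previous values. Its negative sign drives the concavity up to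
    [b2]. *)
Lemma A_h2 : A * h 2%nat bb = lam * delta / (delta + gamma).
Proof.
  destruct lam_spec as [l_lt0 El].
  pose proof (h2_ode mu eta sigma delta eta_gt0 sigma_gt0 delta_gt0 bb) as ode.
  fold h in ode.
  assert (s2 : 0 < sigma ^ 2) by (apply pow_lt; lra).
  apply (Rmult_eq_reg_l (sigma ^ 2 / 2)); [|lra].
  replace (sigma ^ 2 / 2 * (A * h 2%nat bb))
    with (delta * (A * h 0%nat bb) - eta * (A * h 1%nat bb)).
  2: { apply (Rmult_eq_compat_l A) in ode. lra. }
  rewrite A_h0, A_h1.
  replace (sigma ^ 2 / 2 * (lam * delta / (delta + gamma)))
    with ((sigma ^ 2 / 2 * lam ^ 2) * delta / (lam * (delta + gamma))) by (field; lra).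
  replace (sigma ^ 2 / 2 * lam ^ 2) with (delta + gamma - eta * lam) by lra.
  field. lra.
Qed.

Let C3 := c23 mu eta sigma delta gamma b.

Lemma c23_eq : C3 = delta / (lam * (delta + gamma)).
Proof.
  destruct lam_spec as [l_lt0 El].
  unfold C3, c23. fold Mb xb. rewrite b_minus_xb, h2_h2n. fold h.
  replace (exp Mb * delta * kappa mu eta sigma delta / (delta + gamma) * h 0%nat bb)
    with (delta / (delta + gamma) * (A * h 0%nat bb)) by (unfold A; field; lra).
  rewrite A_h0. field. lra.
Qed.

Let P0 := L0 mu eta sigma delta (exp Mb).
Let P1 := L1 mu eta sigma delta (exp Mb).
Let P2 := L2 mu eta sigma delta (exp Mb).

Let Q (n : nat) (x : R) : R := A * h n (x - xb).

(** [A * h 0 bb] stands for [v b2], so that the right piece precedes the pasted function. *)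
Let U0 (x : R) : R :=
  C3 * exp (lam * (x - b))
  + gamma / (gamma + delta) * (x - b + A * h 0%nat bb + eta / (delta + gamma)).
Let U1 (x : R) : R := lam * C3 * exp (lam * (x - b)) + gamma / (gamma + delta).
Let U2 (x : R) : R := lam ^ 2 * C3 * exp (lam * (x - b)).

Lemma b_gt_xb : xb < b.
Proof. destruct bb_spec as [H _]. pose proof b_minus_xb. lra. Qed.

Lemma is_derive_Q (n : nat) (x : R) : is_derive (Q n) x (Q (S n) x).
Proof.
  apply (is_derive_scal (fun x => h n (x - xb))).
  replace (h (S n) (x - xb)) with (scal 1 (h (S n) (x - xb)))
    by (unfold scal; simpl; unfold mult; simpl; ring).
  apply (is_derive_comp (h n) (fun x => x - xb)); [apply is_derive_h2n|].
  auto_derive; [trivial | ring].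
Qed.

Lemma is_derive_U0 (x : R) : is_derive U0 x (U1 x).
Proof. unfold U0, U1. auto_derive; [trivial | unfold Rminus; ring]. Qed.

Lemma is_derive_U1 (x : R) : is_derive U1 x (U2 x).
Proof. unfold U1, U2. auto_derive; [trivial | unfold Rminus; ring]. Qed.

(** Slopes agree by [kappa_Y]; second derivatives because both ratios are [- sigma ^ 2 / mu]; values
    because [L_ode] determines [P0 xb] from the other two. *)
Lemma paste_xb : P0 xb = Q 0 xb /\ P1 xb = Q 1 xb /\ P2 xb = Q 2 xb.
Proof.
  destruct (h2n_0 mu eta sigma delta) as (E0 & E1 & E2); auto. fold h in E0, E1, E2.
  assert (HP1 : P1 xb = A).
  { unfold P1, L1, A. fold y0. rewrite kappa_Y. reflexivity. }
  assert (HP2 : P2 xb = A * h 2%nat 0).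
  { rewrite E2.
    pose proof (L_ratio mu eta sigma delta) as H.
    specialize (H ltac:(auto) ltac:(auto) ltac:(auto) ltac:(auto) (exp Mb)
                  (exp_pos _) xb).
    unfold xb in H. rewrite DX_xb in H by auto. fold xb in H. fold P1 P2 in H.
    rewrite HP1 in H.
    assert (P2 xb < 0) by (apply L2_lt0; auto using exp_pos).
    replace (P2 xb) with (A / (A / P2 xb)) by (field; pose proof A_gt0; lra).
    rewrite H. field. lra. }
  assert (HP0 : P0 xb = A * h 0%nat 0).
  { pose proof (L_ode mu eta sigma delta) as H.
    specialize (H ltac:(auto) ltac:(auto) ltac:(auto) ltac:(auto) (exp Mb)
                  (exp_pos _) xb).
    fold P0 P1 P2 in H. rewrite HP1, HP2, E2 in H. rewrite E0.
    pose proof A_gt0.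
    replace (A ^ 2 / (A * - (mu / sigma ^ 2))) with (- (A * (sigma ^ 2 / mu))) in H
      by (field; lra).
    replace (- (mu ^ 2 / (2 * sigma ^ 2)) * - (A * (sigma ^ 2 / mu)))
      with (A * (mu / 2)) in H by (field; lra).
    apply (Rmult_eq_reg_l delta); [|lra].
    replace (delta * (A * ((2 * eta - mu) / (2 * delta)))) with (A * (eta - mu / 2))
      by (field; lra).
    lra. }
  unfold Q. rewrite Rminus_diag, E1, HP0, HP1, HP2. repeat split; ring.
Qed.

Lemma paste_b : Q 0 b = U0 b /\ Q 1 b = U1 b /\ Q 2 b = U2 b.
Proof.
  destruct lam_spec as [l_lt0 El].
  unfold Q, U0, U1, U2. rewrite b_minus_xb, Rminus_diag, Rmult_0_r, exp_0.
  rewrite A_h0, A_h1, A_h2, c23_eq. repeat split; field; lra.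
Qed.

Definition pasted (f g k : R -> R) : R -> R := glue xb f (glue b g k).

Lemma pasted_left (f g k : R -> R) (x : R) : x <= xb -> pasted f g k x = f x.
Proof. apply glue_left. Qed.

Lemma pasted_middle (f g k : R -> R) (x : R) :
  f xb = g xb -> xb <= x <= b -> pasted f g k x = g x.
Proof.
  intros E Hx. pose proof b_gt_xb. unfold pasted.
  rewrite glue_right; [apply glue_left; lra | rewrite glue_left; auto; lra | lra].
Qed.

Lemma pasted_right (f g k : R -> R) (x : R) :
  f xb = g xb -> g b = k b -> b <= x -> pasted f g k x = k x.
Proof.
  intros E E' Hx. pose proof b_gt_xb. unfold pasted.
  rewrite glue_right; [apply glue_right; auto | rewrite glue_left; auto; lra | lra].
Qed.

Lemma is_derive_pasted (f g k df dg dk : R -> R) :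
  f xb = g xb -> g b = k b -> df xb = dg xb -> dg b = dk b ->
  (forall x, is_derive f x (df x)) -> (forall x, is_derive g x (dg x)) ->
  (forall x, is_derive k x (dk x)) ->
  forall x, is_derive (pasted f g k) x (pasted df dg dk x).
Proof.
  intros. pose proof b_gt_xb. apply is_derive_glue; auto.
  - rewrite glue_left; auto; lra.
  - rewrite glue_left; auto; lra.
  - apply is_derive_glue; auto.
Qed.

Let V := pasted P0 (Q 0) U0.
Let DV := pasted P1 (Q 1) U1.
Let D2V := pasted P2 (Q 2) U2.

(** [h2''] is increasing and, by [A_h2], still negative at [bb]. *)
Lemma Q2_lt0 (x : R) : x <= b -> Q 2 x < 0.
Proof.
  intros x_le. destruct lam_spec as [l_lt0 _]. pose proof A_gt0 as A_pos.
  assert (H : A * h 2%nat bb < 0).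
  { rewrite A_h2. apply Rdiv_neg_pos; [nra | lra]. }
  unfold Q. assert (h 2%nat (x - xb) <= h 2%nat bb); [|nra].
  pose proof b_minus_xb.
  destruct (Req_dec (x - xb) bb) as [->|]; [lra|].
  left. apply h2n_2_increasing; auto. lra.
Qed.

Lemma C3_lt0 : C3 < 0.
Proof.
  destruct lam_spec as [l_lt0 _]. rewrite c23_eq. apply Rdiv_pos_neg; [lra | nra].
Qed.

Lemma U2_lt0 (x : R) : U2 x < 0.
Proof.
  destruct lam_spec as [l_lt0 _]. pose proof C3_lt0. unfold U2.
  pose proof (exp_pos (lam * (x - b))).
  assert (0 < lam ^ 2 * - C3 * exp (lam * (x - b))); [|lra].
  apply Rmult_lt_0_compat; [apply Rmult_lt_0_compat; [nra | lra] | auto].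
Qed.

Lemma U1_gt0 (x : R) : 0 < U1 x.
Proof.
  destruct lam_spec as [l_lt0 _]. pose proof C3_lt0. unfold U1.
  pose proof (exp_pos (lam * (x - b))).
  assert (0 < gamma / (gamma + delta)) by (apply Rdiv_lt_0_compat; lra).
  assert (0 < (- lam) * - C3 * exp (lam * (x - b))); [|lra].
  repeat apply Rmult_lt_0_compat; auto; lra.
Qed.

(** A constant plus a growing exponential with negative coefficient, since [C3 < 0]; so the ratio
    decreases. *)
Lemma U_ratio (x : R) :
  U1 x / U2 x
  = / lam + gamma / (gamma + delta) * (exp (- lam * (x - b)) / (lam ^ 2 * C3)).
Proof.
  destruct lam_spec as [l_lt0 _]. pose proof C3_lt0. unfold U1, U2.
  replace (- lam * (x - b)) with (- (lam * (x - b))) by ring.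
  rewrite exp_Ropp. pose proof (exp_pos (lam * (x - b))). field. lra.
Qed.

Lemma U_ratio_decreasing (x y : R) : x < y -> U1 y / U2 y < U1 x / U2 x.
Proof.
  intros xy. destruct lam_spec as [l_lt0 _]. pose proof C3_lt0.
  rewrite !U_ratio. apply Rplus_lt_compat_l, Rmult_lt_compat_l.
  - apply Rdiv_lt_0_compat; lra.
  - assert (exp (- lam * (x - b)) < exp (- lam * (y - b)))
      by (apply exp_increasing, Rmult_lt_compat_l; lra).
    assert (/ (lam ^ 2 * C3) < 0).
    { apply Rinv_lt_0_compat. assert (0 < lam ^ 2) by nra. nra. }
    unfold Rdiv. nra.
Qed.

Lemma U_ode (x : R) :
  sigma ^ 2 / 2 * U2 x + eta * U1 x - (delta + gamma) * U0 x
  + gamma * (x - b + A * h 0%nat bb) = 0.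
Proof.
  destruct lam_spec as [l_lt0 El]. unfold U0, U1, U2.
  replace (sigma ^ 2 / 2 * (lam ^ 2 * C3 * exp (lam * (x - b))))
    with ((sigma ^ 2 / 2 * lam ^ 2) * (C3 * exp (lam * (x - b)))) by ring.
  replace (sigma ^ 2 / 2 * lam ^ 2) with (delta + gamma - eta * lam) by lra.
  field. lra.
Qed.

(** Division commutes with pasting, so monotonicity can be checked piece by piece. *)
Lemma pasted_ratio (x : R) :
  DV x / D2V x = pasted (fun x => P1 x / P2 x) (fun x => Q 1 x / Q 2 x)
                   (fun x => U1 x / U2 x) x.
Proof.
  unfold DV, D2V, pasted, glue.
  destruct (Rle_dec x xb); [|destruct (Rle_dec x b)]; reflexivity.
Qed.

Lemma ratio_decreasing (x y : R) : x < y -> DV y / D2V y < DV x / D2V x.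
Proof.
  destruct paste_xb as (_ & E1 & E2). destruct paste_b as (_ & E3 & E4).
  pose proof b_gt_xb.
  rewrite !pasted_ratio. apply decreasing_glue.
  - rewrite glue_left, E1, E2; lra.
  - intros x' y' x'y' _. unfold P1, P2. rewrite !L_ratio by auto using exp_pos.
    apply Ropp_lt_contravar, DX_increasing; auto. apply Y_increasing; auto.
  - intros x' y' _. revert x' y'. apply decreasing_glue.
    + rewrite E3, E4; reflexivity.
    + intros x' y' x'y' y'b. unfold Q.
      pose proof (Q2_lt0 x' ltac:(lra)) as Hx. pose proof (Q2_lt0 y' y'b) as Hy.
      unfold Q in Hx, Hy. pose proof A_gt0.
      assert (h 2%nat (x' - xb) < 0) by nra. assert (h 2%nat (y' - xb) < 0) by nra.
      rewrite !Rdiv_mult_l_l by lra.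
      apply h2n_ratio_decreasing; auto; lra.
    + intros x' y' _. apply U_ratio_decreasing.
Qed.

Lemma pasted_verified (v : R -> R) : (forall x, 0 <= x -> v x = V x) ->
  Glb_Rbar (fun x => 0 < x /\ Derive v x < 1) = Finite b /\
  C2_on Rgt0 v /\
  increasing_on Rgt0 v /\
  concave_on Rgt0 v /\
  HJB_solution mu eta sigma delta gamma v /\
  (forall x, 0 < x -> Derive_n v 2 x <> 0) /\
  decreasing_on Rgt0 (fun x => Derive v x / Derive_n v 2 x) /\
  (exists l : R,
     filterlim (fun x => mu / sigma ^ 2 * (Derive v x / Derive_n v 2 x))
       (at_right 0) (locally l) /\
     -1 < l) /\
  Glb_Rbar (fun x => 0 < x /\
     1 <= - (mu / sigma ^ 2) * (Derive v x / Derive_n v 2 x))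
    = Finite xb.
Proof.
  destruct paste_xb as (E1 & E2 & E3). destruct paste_b as (E4 & E5 & E6).
  pose proof b_gt_xb as bxb.
  assert (xb_gt0 : 0 < xb) by (apply x_bar_gt0; auto).
  assert (Vb : V b = A * h 0%nat bb).
  { unfold V. rewrite pasted_middle by (auto; lra). unfold Q.
    rewrite b_minus_xb. reflexivity. }
  apply (verification mu eta sigma delta gamma xb b V DV D2V); auto; try lra.
  - apply is_derive_pasted; auto.
    + intros x. apply is_derive_L0; auto using exp_pos.
    + apply is_derive_Q.
    + apply is_derive_U0.
  - apply is_derive_pasted; auto.
    + intros x. apply is_derive_L1; auto using exp_pos.
    + apply is_derive_Q.
    + apply is_derive_U1.
  - apply continuous_glue; [|intros x; apply continuous_L2; auto using exp_pos|].
    { rewrite glue_left; auto; lra. }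
    apply continuous_glue; auto.
    + intros x. apply @ex_derive_continuous. exists (Q 3 x). apply is_derive_Q.
    + intros x. apply @ex_derive_continuous. unfold U2. auto_derive. trivial.
  (* [X 0 = 0] gives [Y 0 = 0], so the factor [exp (p * Y 0) - 1] vanishes. *)
  - unfold V. rewrite pasted_left by lra. unfold P0, L0.
    rewrite <- (X_0 mu eta sigma delta) at 2. rewrite Y_X by auto.
    rewrite Rmult_0_r, exp_0. ring.
  - intros x. unfold DV, pasted, glue.
    destruct (Rle_dec x xb); [|destruct (Rle_dec x b)].
    + apply L1_gt0; auto using exp_pos.
    + apply Rmult_lt_0_compat; [apply A_gt0 | apply h1_gt0].
    + apply U1_gt0.
  - intros x. unfold D2V, pasted, glue.
    destruct (Rle_dec x xb); [|destruct (Rle_dec x b)].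
    + apply L2_lt0; auto using exp_pos.
    + apply Q2_lt0; auto.
    + apply U2_lt0.
  - unfold DV. rewrite pasted_middle by (auto; lra). unfold Q.
    rewrite b_minus_xb. apply A_h1.
  - apply ratio_decreasing.
  - unfold DV, D2V. rewrite !pasted_left by lra.
    unfold P1, P2. rewrite L_ratio by auto using exp_pos.
    unfold xb. rewrite DX_xb by auto. reflexivity.
  - intros x Hx. unfold V, DV, D2V. rewrite !pasted_left by lra.
    apply L_ode; auto using exp_pos.
  - intros x Hx. unfold V, DV, D2V. rewrite !pasted_middle by auto.
    pose proof (h2_ode mu eta sigma delta eta_gt0 sigma_gt0 delta_gt0 (x - xb)) as ode.
    fold h in ode. apply (Rmult_eq_compat_l A) in ode. unfold Q. lra.
  - intros x Hx. rewrite Vb. unfold V, DV, D2V. rewrite !pasted_right by auto.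
    apply U_ode.
Qed.

(** * Identification of the candidate with the pasted function *)

Lemma P0_x1_inv (x : R) : 0 <= x <= xb ->
  P0 x = c21 mu eta sigma delta * exp (- x1_inv mu eta sigma delta gamma b x)
         * (exp (p * (Mb + x1_inv mu eta sigma delta gamma b x)) - 1).
Proof.
  intros Hx. rewrite x1_inv_Y by auto. fold Mb.
  unfold P0, L0. fold p y0.
  replace (- (y0 x - Mb)) with (Mb + - y0 x) by ring.
  rewrite exp_plus. replace (Mb + (y0 x - Mb)) with (y0 x) by ring. ring.
Qed.

Lemma continuous_V (x : R) : continuous V x.
Proof.
  destruct paste_xb as (E1 & E2 & E3). destruct paste_b as (E4 & E5 & E6).
  apply @ex_derive_continuous. exists (DV x). apply is_derive_pasted; auto.
  - intros y. apply is_derive_L0; auto using exp_pos.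
  - apply is_derive_Q.
  - apply is_derive_U0.
Qed.

Lemma is_candidate_V : is_candidate mu eta sigma delta gamma b V.
Proof.
  destruct paste_xb as (E1 & E2 & E3). destruct paste_b as (E4 & E5 & E6).
  pose proof b_gt_xb as bxb.
  assert (xb_gt0 : 0 < xb) by (apply x_bar_gt0; auto).
  split; [|split; [|split; [|split; [|split]]]].
  - unfold V. rewrite pasted_left by lra. unfold P0, L0.
    rewrite <- (X_0 mu eta sigma delta) at 2. rewrite Y_X by auto.
    rewrite Rmult_0_r, exp_0. ring.
  - intros x Hx. fold xb in Hx. unfold V. rewrite pasted_left by lra.
    apply P0_x1_inv. lra.
  - intros x Hx. fold xb in Hx |- *. unfold V. rewrite pasted_middle by (auto; lra).
    rewrite h2_h2n. reflexivity.
  - intros x Hx. unfold V at 1. rewrite pasted_right by (auto; lra).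
    unfold V. rewrite pasted_middle by (auto; lra). unfold U0, Q.
    rewrite b_minus_xb. reflexivity.
  - apply continuous_V.
  - apply continuous_V.
Qed.

(** Continuity from the left fixes the values at [xb] and [b]. The latter must come before the right
    piece, whose formula contains [v b]. *)
Lemma is_candidate_eq_V (v : R -> R) :
  is_candidate mu eta sigma delta gamma b v -> forall x, 0 <= x -> v x = V x.
Proof.
  intros (v0 & vl & vm & vr & cx & cb).
  destruct is_candidate_V as (V0 & Vl & Vm & Vr & Cx & Cb).
  fold xb in vl, vm, cx, Vl, Vm, Cx. pose proof b_gt_xb as bxb.
  assert (xb_gt0 : 0 < xb) by (apply x_bar_gt0; auto).
  assert (Exb : v xb = V xb).
  { apply (continuous_eq_left v V 0); auto.
    intros y Hy. rewrite vl, Vl; auto. }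
  assert (Eb : v b = V b).
  { apply (continuous_eq_left v V xb); auto.
    intros y Hy. rewrite vm, Vm; auto. }
  intros x x_ge0.
  destruct (Req_dec x 0) as [->|]; [congruence|].
  destruct (Rtotal_order x xb) as [|[->|]]; auto.
  - rewrite vl, Vl; auto; lra.
  - destruct (Rtotal_order x b) as [|[->|]]; auto.
    + rewrite vm, Vm; auto; lra.
    + rewrite vr, Vr, Eb; auto.
Qed.

End Pasting.

Theorem proposition3p7 (mu eta sigma delta gamma : R)
  (eta_gt0 : 0 < eta) (sigma_gt0 : 0 < sigma)
  (delta_gt0 : 0 < delta) (gamma_gt0 : 0 < gamma)
  (eta_lt_mu : eta < mu) (mu_lt_2eta : mu < 2 * eta)
  (gamma1_lt_gamma : gamma1 mu eta sigma delta < gamma) :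
  let xbar := x_bar mu eta sigma delta in
  let b2 := b2_gamma mu eta sigma delta gamma in
  (exists v : R -> R, is_candidate mu eta sigma delta gamma b2 v) /\
  (forall v : R -> R, is_candidate mu eta sigma delta gamma b2 v ->
     Glb_Rbar (fun x => 0 < x /\ Derive v x < 1) = Finite b2 /\
     C2_on Rgt0 v /\
     increasing_on Rgt0 v /\
     concave_on Rgt0 v /\
     HJB_solution mu eta sigma delta gamma v /\
     (forall x, 0 < x -> Derive_n v 2 x <> 0) /\
     decreasing_on Rgt0 (fun x => Derive v x / Derive_n v 2 x) /\
     (exists l : R,
        filterlim (fun x => mu / sigma ^ 2 * (Derive v x / Derive_n v 2 x))
          (at_right 0) (locally l) /\
        -1 < l) /\
     Glb_Rbar (fun x => 0 < x /\
        1 <= - (mu / sigma ^ 2) * (Derive v x / Derive_n v 2 x))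
       = Finite xbar).
Proof.
  intros xbar b2. split.
  - eexists. apply is_candidate_V; auto.
  - intros v Hv. apply pasted_verified; auto.
    apply is_candidate_eq_V; auto.
Qed.
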